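(* Let $(\mathcal C_n)$ be a regenerative composition structure derived by uniform sampling from a random closed set $\widetilde{\mathcal R}\subset[0,1]$. Let $F_n$ be the size of the first part of $\mathcal C_n$ and $L_n$ the size of the last part of $\mathcal C_n$. The following conditions are equivalent: (i) $\mathbb P(F_n=1)=\mathbb P(L_n=1)$ for all $n$; (ii) $F_n\stackrel{d}{=}L_n$ for all $n$; (iii) $(\mathcal C_n)$ is reversible; (iv) $(\mathcal C_n)$ is symmetric; (v) for some $\alpha\in[0,1]$, $(\mathcal C_n)$ is the regenerative composition structure with composition probability function $$p(n_1,\dots,n_k)=\frac{n!}{[\alpha]_n}\,\alpha^k\prod_{j=1}^k\frac{[1-\alpha]_{n_j-1}}{n_j!},\qquad n=n_1+\dots+n_k,$$ where for $\alpha=0$ this is understood as the limit $\alpha\downarrow0$, that is $p(n)=1$ for all $n$.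
   Context: A composition of $n$ is a sequence of positive integers (its parts) with sum $n$. A composition structure $(\mathcal C_n)_{n\ge1}$ is a Markovian sequence of random compositions $\mathcal C_n$ of $n$ such that, if $n$ identical balls are distributed into an ordered series of boxes according to $\mathcal C_n$, then $\mathcal C_{n-1}$ is obtained by discarding one of the balls picked uniformly at random and then deleting an empty box in case one is created. Its composition probability function is $p(\lambda)=\mathbb P(\mathcal C_n=\lambda)$ for $\lambda$ a composition of $n$. It is regenerative if for all $n>m\ge1$, given that the first part of $\mathcal C_n$ is $m$, the remaining composition of $n-m$ is distributed like $\mathcal C_{n-m}$. Closed subsets of $[0,1]$ are always assumed to contain $0$ and $1$. $(\mathcal C_n)$ is derived by uniform sampling from $\widetilde{\mathcal R}$ if it is obtained as follows: take i.i.d. uniform $[0,1]$ variables $u_1,u_2,\dots$ independent of $\widetilde{\mathcal R}$, with order statistics $u_{1n}<\dots<u_{nn}$ of the first $n$; put $j$ and $j+1$ in different blocks iff $[u_{jn},u_{j+1,n}]\cap\widetilde{\mathcal R}\ne\emptyset$; $\mathcal C_n$ is the sequence of sizes of the resulting blocks of consecutive integers from left to right. (Every composition structure arises this way.) $(\mathcal C_n)$ is reversible if for every $n$ the sequence of parts of $\mathcal C_n$ in reverse order has the same law as $\mathcal C_n$ (equivalently $\widetilde{\mathcal R}\stackrel{d}{=}1-\widetilde{\mathcal R}$). It is symmetric if for each $k$ the function $p(n_1,\dots,n_k)$ is symmetric under all permutations of its arguments. $[x]_n=x(x+1)\cdots(x+n-1)$, $[x]_0=1$. *)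

(* Defs.v *)
From HB Require Import structures.
From mathcomp Require Export all_boot all_order all_algebra.
From mathcomp Require Export all_classical all_reals all_analysis.

Set Implicit Arguments.
Unset Strict Implicit.
Unset Printing Implicit Defensive.

Export Order.TTheory GRing.Theory Num.Theory.
Export numFieldNormedType.Exports.

#[export] Set Implicit Arguments.
#[export] Unset Strict Implicit.
#[export] Unset Printing Implicit Defensive.

Local Open Scope classical_set_scope.
Local Open Scope ring_scope.

Definition is_composition (n : nat) (l : seq nat) : bool :=
  all (leq 1) l && (sumn l == n).

Definition first_part (l : seq nat) : nat := head 0%N l.
Definition last_part (l : seq nat) : nat := last 0%N l.

(* Discard one ball from the i-th box, and delete that box if it becomes
   empty; when all parts of [l] are positive no other box is affected. *)
Definition discard (l : seq nat) (i : nat) : seq nat :=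
  [seq m <- set_nth 0%N l i (nth 0%N l i).-1 | m != 0%N].

(* The probability that [l] is turned into [l'] when the ball to be discarded
   is uniform among the [sumn l] balls, so that it comes from the i-th box
   with probability [nth 0 l i / sumn l]. *)
Definition discard_prob (R : realType) (l l' : seq nat) : R :=
  \sum_(i < size l | discard l i == l') (nth 0%N l i)%:R / (sumn l)%:R.

Section Probability.
Context {d : measure_display} {T : measurableType d} {R : realType}.
Variable P : probability T R.

Definition Pr (A : set T) : R := fine (P A).

(* Only meaningful when [Pr B] is positive. *)
Definition cPr (A B : set T) : R := Pr (A `&` B) / Pr B.

(* Meant for random variables with values in a countable type whose
   singletons have measurable preimages, so that all the events below are
   measurable. *)
Definition eq_law (S : Type) (X Y : T -> S) : Prop :=
  forall A : set S, Pr (X @^-1` A) = Pr (Y @^-1` A).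

Definition mutually_independent (u : nat -> {RV P >-> R}) : Prop :=
  forall (J : seq nat) (B : nat -> set R), uniq J ->
    (forall j, measurable (B j)) ->
    Pr (\bigcap_(j in [set` J]) (u j @^-1` B j)) =
    \prod_(j <- J) Pr (u j @^-1` B j).

Definition iid_uniform (u : nat -> {RV P >-> R}) : Prop :=
  mutually_independent u /\
  forall (i : nat) (B : set R), measurable B ->
    P (u i @^-1` B) = uniform_prob (@ltr01 R) B.

Definition hits (Rt : T -> set R) (K : set R) : set T :=
  [set w | (Rt w `&` K) !=set0].

(* Closed subsets of [0, 1] are required to contain 0 and 1. *)
Definition random_closed_set (Rt : T -> set R) : Prop :=
  (forall w, [/\ closed (Rt w), Rt w `<=` `[0, 1], Rt w 0 & Rt w 1]) /\
  (forall K : set R, compact K -> measurable (hits Rt K)).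

Definition sigma_closed_set (Rt : T -> set R) : set (set T) :=
  <<s [set hits Rt K | K in [set K : set R | compact K]] >>.

Definition sigma_sequence (u : nat -> {RV P >-> R}) : set (set T) :=
  <<s [set A | exists (i : nat) (B : set R),
                 measurable B /\ A = u i @^-1` B] >>.

Definition independent_of (Rt : T -> set R) (u : nat -> {RV P >-> R}) : Prop :=
  forall A B : set T, sigma_closed_set Rt A -> sigma_sequence u B ->
    Pr (A `&` B) = Pr A * Pr B.

End Probability.

(* Cut [s] between every two consecutive entries related by [sep] and list
   the sizes of the resulting blocks ([incr_nth b 0] adds one to the head of
   [b]). *)
Fixpoint block_sizes (A : Type) (sep : A -> A -> bool) (s : seq A) : seq nat :=
  match s with
  | [::] => [::]
  | x :: s' =>
    match s' with
    | [::] => [:: 1%N]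
    | y :: _ => let b := block_sizes sep s' in
                if sep x y then 1%N :: b else incr_nth b 0
    end
  end.

(* The sample points are indexed from 0; they are almost surely distinct, so
   the sorted sequence is the sequence of order statistics. *)
Definition sampled_composition (R : realType) (F : set R) (x : nat -> R)
    (n : nat) : seq nat :=
  block_sizes (fun a b : R => `[< (`[a, b] `&` F) !=set0 >])
              (sort <=%R [seq x i | i <- iota 0 n]).

Section CompositionStructures.
Context {d : measure_display} {T : measurableType d} {R : realType}.
Variable P : probability T R.
(* [C n] is the random composition of [n]; the value of [C 0] is irrelevant. *)
Variable C : nat -> T -> seq nat.

Definition random_compositions : Prop :=
  forall n, (0 < n)%N ->
    (forall w, is_composition n (C n w)) /\
    (forall l, measurable [set w | C n w = l]).

Definition markovian : Prop :=
  forall (n : nat) (l : nat -> seq nat), (0 < n)%N ->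
    let past := [set w | forall i, (0 < i <= n)%N -> C i w = l i] in
    0 < Pr P past ->
    cPr P [set w | C n.+1 w = l n.+1] past =
    cPr P [set w | C n.+1 w = l n.+1] [set w | C n w = l n].

Definition sampling_consistent : Prop :=
  forall (n : nat) (l l' : seq nat), (0 < n)%N ->
    0 < Pr P [set w | C n.+1 w = l] ->
    cPr P [set w | C n w = l'] [set w | C n.+1 w = l] = discard_prob R l l'.

Definition composition_structure : Prop :=
  [/\ random_compositions, markovian & sampling_consistent].

Definition cpf (l : seq nat) : R := Pr P [set w | C (sumn l) w = l].

Definition regenerative : Prop :=
  forall n m : nat, (0 < m < n)%N ->
    let first_is_m := [set w | first_part (C n w) = m] in
    0 < Pr P first_is_m ->
    forall A : set (seq nat),
      cPr P [set w | A (behead (C n w))] first_is_m =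
      Pr P [set w | A (C (n - m)%N w)].

Definition derived_by_uniform_sampling (Rt : T -> set R) : Prop :=
  exists u : nat -> {RV P >-> R},
    [/\ iid_uniform u, independent_of Rt u &
        forall n, (0 < n)%N ->
          {ae P, forall w, C n w = sampled_composition (Rt w) (fun i => u i w) n}].

Definition reversible : Prop :=
  forall n, (0 < n)%N -> eq_law P (fun w => rev (C n w)) (C n).

Definition symmetric_structure : Prop :=
  forall l l' : seq nat, l != [::] -> all (leq 1) l -> perm_eq l l' ->
    cpf l = cpf l'.

End CompositionStructures.

Definition rising (R : realType) (x : R) (n : nat) : R :=
  \prod_(i < n) (x + i%:R).

(* For alpha = 0 the generic formula is 0 / 0; its limit as alpha decreases
   to 0 is 1 on one-part compositions and 0 on the others. *)
Definition alpha_cpf (R : realType) (alpha : R) (l : seq nat) : R :=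
  if alpha == 0 then (size l == 1%N)%:R
  else (sumn l)`!%:R / rising alpha (sumn l) * alpha ^+ size l *
       \prod_(m <- l) (rising (1 - alpha) m.-1 / m`!%:R).

(* Main.v *)
Require Import Defs.
From mathcomp Require Import ring lra.
Local Open Scope classical_set_scope.
Local Open Scope ring_scope.

(* Only (i) -> (v) has content.  Let q(n, m) = P(F_n = m).  By regeneration the
   composition probabilities are products of q's, so it suffices to find q.
   Sampling consistency makes psi(n, m) = Phi(n) q(n, m) / C(n, m) obey the
   additive rule psi(n, m) = psi(n+1, m) + psi(n+1, m+1), where Phi(1) = 1 and
   Phi(n-1) / Phi(n) = 1 - q(n, 1) / n; hence Phi determines q.  The first-part
   recursion for P(L_n = 1), combined with this rule, shows that P(L_n = 1) / n
   is the backward difference of order n-1 at 1 of the sequence 1 / Phi, so (i)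
   reads: this difference is 1 - Phi(n-1) / Phi(n).  This equation is affine in
   1 / Phi(n), with coefficient Phi(n-1) + (-1)^(n-1), which is nonzero for
   n > 2 as soon as Phi(2) > 1.  Therefore Phi(2) = 1 + alpha determines Phi,
   and the explicit alpha-solution must be the one; if Phi(2) = 1, then Phi is
   constant and C_n = (n). *)

(** * Backward differences *)

Section Differences.
Variable R : comRingType.
Implicit Type a : nat -> R.

Fixpoint bdiff a (k j : nat) : R :=
  if k is k'.+1 then bdiff a k' j - bdiff a k' j.+1 else a j.

Lemma bdiff0 a j : bdiff a 0 j = a j. Proof. by []. Qed.

Lemma bdiffS a k j : bdiff a k.+1 j = bdiff a k j - bdiff a k j.+1.
Proof. by []. Qed.

(** The top entry enters a difference of order [k] with coefficient [(-1) ^+ k], and all lower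
    entries cancel. This makes the equation for each new value of 1 / Phi affine. *)
Lemma bdiff_top a b k j :
  (forall i, (i < j + k)%N -> a i = b i) ->
  bdiff a k j - bdiff b k j = (-1) ^+ k * (a (j + k)%N - b (j + k)%N).
Proof.
elim: k j => [|k IHk] j eq_ab; first by rewrite addn0 mul1r !bdiff0.
rewrite !bdiffS.
have -> : bdiff a k j = bdiff b k j.
  apply/eqP; rewrite -subr_eq0 IHk => [|i ltij].
    by rewrite eq_ab ?addnS // subrr mulr0.
  by apply: eq_ab; rewrite addnS ltnS ltnW.
rewrite exprS -mulrA addnS -addSn -IHk ?mulN1r => [|i ltij]; first by ring.
by apply: eq_ab; rewrite addnS.
Qed.

Lemma bdiff_cst (c : R) k j : bdiff (fun=> c) k.+1 j = 0.
Proof. by elim: k j => [|k IHk] j; rewrite bdiffS ?subrr // !IHk subrr. Qed.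

(* A binomial convolution of two triangular arrays obeying Pascal's additive
   rule obeys it as well, so it is determined by its row k = 0. *)
Lemma bdiff_convolution a (psi : nat -> nat -> R) :
  (forall n m, (m <= n.+1)%N -> psi n m = psi n.+1 m + psi n.+1 m.+1) ->
  forall k j, \sum_(m < k.+1) 'C(k, m)%:R * psi (j + k)%N m * bdiff a (k - m) j
              = bdiff (fun i => psi i 0%N * a i) k j.
Proof.
move=> psiD; elim=> [|k IHk] j.
  by rewrite big_ord1 addn0 bin0 mul1r !bdiff0.
rewrite bdiffS -!IHk big_ord_recl /= bin0 mul1r addnS.
(* Pascal's rule splits the sum; in the second half the index is then shifted back, at the cost of a
   boundary term at [m = 0]. *)
have -> : \sum_(i < k.+1) 'C(k.+1, lift ord0 i)%:R * psi (j + k).+1 (lift ord0 i)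
             * bdiff a (k.+1 - lift ord0 i) j =
    \sum_(i < k.+1) 'C(k, i)%:R * psi (j + k).+1 i.+1 * bdiff a (k - i) j +
    \sum_(i < k.+1) 'C(k, i.+1)%:R * psi (j + k).+1 i.+1 * bdiff a (k - i) j.
  rewrite -big_split; apply: eq_bigr => i _ /=.
  by rewrite /bump add1n subSS binS natrD; ring.
have -> : \sum_(i < k.+1) 'C(k, i.+1)%:R * psi (j + k).+1 i.+1 * bdiff a (k - i) j
    = \sum_(i < k.+1) 'C(k, i)%:R * psi (j + k).+1 i * bdiff a (k.+1 - i) j
      - psi (j + k).+1 0%N * bdiff a k.+1 j.
  rewrite big_ord_recr /= bin_small // 2!mul0r addr0.
  rewrite big_ord_recl /= bin0 mul1r.
  rewrite addrC addKr; apply: eq_bigr => i _ /=.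
  by rewrite /bump add1n subSS.
rewrite [psi _ 0%N * _ + _]addrC -addrA subrK -big_split -sumrB /=.
apply: eq_bigr => i _; rewrite addSn [psi (j + k)%N i]psiD; last first.
  by apply: leq_trans (ltnW (ltn_ord i)) _; rewrite ltnS leq_addl.
by rewrite subSn -1?ltnS // bdiffS; ring.
Qed.

End Differences.

Arguments bdiff : simpl never.

(** * The alpha-solution *)

Section Rising.
Variable R : realType.
Implicit Types x y al : R.

Lemma rising0 x : rising x 0 = 1.
Proof. by rewrite /rising big_ord0. Qed.

Lemma risingS x n : rising x n.+1 = rising x n * (x + n%:R).
Proof. by rewrite /rising big_ord_recr. Qed.

Lemma risingSl x n : rising x n.+1 = x * rising (x + 1) n.
Proof.
rewrite /rising big_ord_recl addr0; congr (_ * _); apply: eq_bigr => i _.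
by rewrite /= /bump add1n -addn1 natrD; ring.
Qed.

Lemma rising_gt0 x n : 0 < x -> 0 < rising x n.
Proof. by move=> x_gt0; apply: prodr_gt0 => i _; rewrite ltr_pwDl. Qed.

(* 1 / Phi(n+1) for the alpha-structure, normalised by Phi(1) = 1. *)
Definition alpha_inv_phi al n : R := n`!%:R / rising (al + 1) n.

(** A Beta integral: for [al > 0], [alpha_inv_phi al j] is [al] times the integral of x^(al-1)
    (1-x)^j over [0, 1], and each difference inserts a factor x. *)
Lemma bdiff_alpha_inv_phi al k j : 0 <= al ->
  bdiff (alpha_inv_phi al) k j = rising al k * j`!%:R / rising (al + 1) (j + k).
Proof.
move=> al_ge0.
have ris_neq0 n : rising (al + 1) n != 0.
  by rewrite gt_eqF // rising_gt0 // ltr_wpDl.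
elim: k j => [|k IHk] j; first by rewrite bdiff0 rising0 mul1r addn0.
rewrite bdiffS.
have fne : al + 1 + (j + k)%:R != 0 by rewrite gt_eqF // ltr_pwDl // ltr_wpDl.
rewrite !IHk addSn addnS !risingS factS natrM -addn1 2!natrD.
by rewrite natrD in fne; field; rewrite ris_neq0 fne.
Qed.

(** Here [phi n] stands for Phi(n+1). At [n = 0] the difference equation is an identity, so [phi 1]
    stays free; if it exceeds 1, each later equation fixes one new value. *)
Lemma phi_unique (phi : nat -> R) :
  phi 0%N = 1 -> {homo phi : m n / (m <= n)%N >-> m <= n} ->
  (phi 1%N = 1 -> forall n, phi n = 1) ->
  (forall n, bdiff (fun i => (phi i)^-1) n.+1 0 = 1 - phi n / phi n.+1) ->
  forall n, (phi n)^-1 = alpha_inv_phi (phi 1%N - 1) n.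
Proof.
move=> phi0 phi_homo phi_cst phi_diff.
have phi_ge1 n : 1 <= phi n by rewrite -phi0; exact: phi_homo.
set al := phi 1%N - 1.
have al_ge0 : 0 <= al by rewrite subr_ge0.
have risP n : rising (al + 1) n != 0.
  by rewrite gt_eqF // rising_gt0 // ltr_wpDl.
(* At [al = 0] the coefficient [v + (-1) ^+ n.+2] used below vanishes for odd [n], hence the
   separate hypothesis that [phi] is then constant. *)
have [al0|al_neq0] := eqVneq al 0.
  have phi1 : phi 1%N = 1 by apply/eqP; rewrite -subr_eq0 -/al al0.
  elim=> [|n IHn]; first by rewrite phi0 /alpha_inv_phi rising0 divr1 invr1.
  move: IHn; rewrite /alpha_inv_phi al0 add0r !(phi_cst phi1) invr1 => IHn.
  have n1 : (1 : R) + n%:R != 0 by rewrite gt_eqF // ltr_pwDl.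
  rewrite factS natrM risingS [rising _ _ * _]mulrC -natr1 [_ + 1]addrC.
  by rewrite -mulf_div -IHn mulr1 divff.
have al_gt0 : 0 < al by rewrite lt_neqAle eq_sym al_neq0.
elim/ltn_ind=> -[_|[_|n IHn]].
- by rewrite phi0 /alpha_inv_phi rising0 divr1 invr1.
- by rewrite /alpha_inv_phi risingS rising0 addr0 !mul1r /al subrK.
have := @bdiff_top _ (fun i => (phi i)^-1) (alpha_inv_phi al) n.+2 0.
move=> /(_ IHn); rewrite phi_diff bdiff_alpha_inv_phi // add0n.
have -> : phi n.+1 = (alpha_inv_phi al n.+1)^-1 by rewrite -IHn // invrK.
have : 1 < (alpha_inv_phi al n.+1)^-1.
  rewrite -IHn // invrK; apply: lt_le_trans (phi_homo 1%N _ _) => //.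
  by rewrite -subr_gt0.
set u := (phi n.+2)^-1 => phi_gt1.
set b := alpha_inv_phi al n.+2.
(* The alpha-solution satisfies the same equation: both sides equal al / (al + n + 2). *)
have -> : rising al n.+2 * 0`!%:R / rising (al + 1) n.+2 =
          1 - (alpha_inv_phi al n.+1)^-1 * b.
  rewrite /b /alpha_inv_phi risingSl [rising (al + 1) n.+2]risingS mulr1.
  rewrite [n.+2`!]factS natrM.
  have f1 : (n.+1)`!%:R != 0 :> R by rewrite pnatr_eq0 -lt0n fact_gt0.
  have fne : al + 1 + n.+1%:R != 0 by rewrite gt_eqF // ltr_pwDl // ltr_wpDl.
  rewrite -[n.+2%:R]natr1; move: n.+1%:R fne => x fne.
  by field; rewrite fne f1 risP.
move=> E; apply/eqP; rewrite -subr_eq0; apply/eqP.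
set v := (alpha_inv_phi al n.+1)^-1 in phi_gt1 E *.
(* The two equations subtract to this product, whose first factor is positive because [v > 1]. *)
have : (v + (-1) ^+ n.+2) * (u - b) = 0.
  by rewrite mulrDl -E; ring.
move/eqP; rewrite mulf_eq0 => /orP[|/eqP//].
rewrite gt_eqF // -signr_odd; case: (odd _); rewrite ?expr1 ?expr0.
  by rewrite subr_gt0.
by rewrite addr_gt0 // (lt_trans _ phi_gt1).
Qed.

End Rising.

(** * Regenerative factorisation of the alpha formula *)

Section AlphaFormula.
Variables (R : realType) (al : R).
Hypothesis al_ge0 : 0 <= al.

Lemma alpha_cpf_perm (l l' : seq nat) :
  perm_eq l l' -> alpha_cpf al l = alpha_cpf al l'.
Proof.
move=> ll'; rewrite /alpha_cpf (perm_size ll') (perm_sumn ll').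
by rewrite (perm_big _ ll').
Qed.

(* The factor al of [rising al n] is cancelled against the numerator, so that
   the formula also holds at al = 0. *)
Definition alpha_decrement (n m : nat) : R :=
  'C(n, m)%:R * rising (1 - al) m.-1 * rising al (n - m) / rising (al + 1) n.-1.

Lemma alpha_cpf1 m : (0 < m)%N -> alpha_cpf al [:: m] = alpha_decrement m m.
Proof.
move=> m_gt0; rewrite /alpha_cpf /alpha_decrement /= big_seq1 addn0.
have ris0 n : rising (al + 1) n != 0.
  by rewrite gt_eqF // rising_gt0 // ltr_wpDl.
rewrite subnn binn rising0 mul1r mulr1; case: eqVneq => [->|al0].
  by rewrite subr0 add0r divff // lt0r_neq0 // rising_gt0.
case: m m_gt0 => // m _; rewrite risingSl /=.
have f0 : (m.+1)`!%:R != 0 :> R by rewrite pnatr_eq0 -lt0n fact_gt0.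
by field; rewrite f0 ris0 al0.
Qed.

(** The formula is a product over parts, so splitting off the first one leaves the same formula on
    the rest. At [al = 0] both sides vanish, as [l] is nonempty. *)
Lemma alpha_cpf_cons m l : (0 < m)%N -> (0 < sumn l)%N ->
  alpha_cpf al (m :: l) = alpha_decrement (m + sumn l) m * alpha_cpf al l.
Proof.
move=> m_gt0 s_gt0; rewrite /alpha_cpf /alpha_decrement /= big_cons addKn.
have ris0 n : rising (al + 1) n != 0.
  by rewrite gt_eqF // rising_gt0 // ltr_wpDl.
case: l s_gt0 => // m' l s_gt0; set s := sumn (m' :: l) in s_gt0 *.
case: eqVneq => [->|al0].
  by rewrite -(prednK s_gt0) risingSl !(mul0r, mulr0).
have al_gt0 : 0 < al by rewrite lt_neqAle eq_sym al0.
have := rising_gt0 s al_gt0 => /lt0r_neq0 ps.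
have -> : (m + s)`!%:R = 'C(m + s, m)%:R * (m`!%:R * s`!%:R) :> R.
  by rewrite -!natrM -(bin_fact (leq_addr s m)) addKn.
have -> : rising al (m + s) = al * rising (al + 1) (m + s).-1.
  by rewrite -risingSl prednK // addn_gt0 m_gt0.
have f0 : m`!%:R != 0 :> R by rewrite pnatr_eq0 -lt0n fact_gt0.
rewrite exprS.
by field; rewrite f0 ris0 al0 ps.
Qed.

End AlphaFormula.

(** * Decrement matrices *)

Section DecrementMatrix.
Variables (R : realType) (q : nat -> nat -> R).
Hypothesis q_ge0 : forall n m, 0 <= q n m.
Hypothesis q_le1 : forall n m, q n.+1 m <= 1.
Hypothesis q11 : q 1 1 = 1.
Hypothesis q_rec : forall n m, (0 < m <= n.+1)%N ->
  q n.+1 m = (m.+1)%:R / n.+2%:R * q n.+2 m.+1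
             + (n.+2 - m)%:R / n.+2%:R * q n.+2 m
             + q n.+2 1 * q n.+1 m / n.+2%:R.

(* [phi n] is Phi(n+1) / Phi(1) for the Laplace exponent Phi attached to the
   regenerative structure. *)
Definition phi n : R := \prod_(i < n) (i.+2%:R / (i.+2%:R - q i.+2 1)).

(* Up to normalisation, for m > 0, the integral of x^m (1-x)^(n+1-m) against
   the Levy measure of Phi; the value at m = 0 extends the additive rule. *)
Definition psi n m : R :=
  if m == 0%N then - phi n else phi n * q n.+1 m / 'C(n.+1, m)%:R.

Lemma phi0 : phi 0 = 1. Proof. by rewrite /phi big_ord0. Qed.

Lemma decrement_factor_gt0 n : 0 < n.+2%:R - q n.+2 1.
Proof. by rewrite subr_gt0 (le_lt_trans (q_le1 _ _)) // ltr1n. Qed.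

Lemma phiS n : phi n.+1 * (1 - q n.+2 1 / n.+2%:R) = phi n.
Proof.
have := lt0r_neq0 (decrement_factor_gt0 n).
have n2 : n.+2%:R != 0 :> R by rewrite pnatr_eq0.
rewrite /phi big_ord_recr /=; move: n.+2%:R n2 => x x0 xq.
by field; rewrite x0 xq.
Qed.

Lemma phi_gt0 n : 0 < phi n.
Proof.
by apply: prodr_gt0 => i _; rewrite divr_gt0 ?ltr0n ?decrement_factor_gt0.
Qed.

Lemma phi_le : {homo phi : m n / (m <= n)%N >-> m <= n}.
Proof.
apply: homo_leq => [x|x y z|n]; [exact: lexx | exact: le_trans |].
rewrite -(phiS n) (ler_piMr (ltW (phi_gt0 _))) // gerBl.
by rewrite divr_ge0 ?ler0n.
Qed.

Lemma bin_neq0 n m : (m <= n)%N -> 'C(n, m)%:R != 0 :> R.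
Proof. by move=> le_mn; rewrite pnatr_eq0 -lt0n bin_gt0. Qed.

(** For [m = 0] this is [phiS]. For [m > 0], the last term of [q_rec] moves to the left, where its
    factor turns [phi n.+1] into [phi n]; the binomials absorb the other coefficients. *)
Lemma psiD n m : (m <= n.+1)%N -> psi n m = psi n.+1 m + psi n.+1 m.+1.
Proof.
case: m => [_|m le_mn].
  by rewrite /psi /= bin1 -{1}(phiS n); ring.
rewrite /psi /=.
have n2 : n.+2%:R != 0 :> R by rewrite pnatr_eq0.
have m2 : m.+2%:R != 0 :> R by rewrite pnatr_eq0.
have nm : (n.+2 - m.+1)%:R != 0 :> R by rewrite pnatr_eq0 subn_eq0 -ltnNge.
have C1 := bin_neq0 le_mn.
have phi_q : phi n * q n.+1 m.+1 = phi n.+1 *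
    ((m.+2)%:R / n.+2%:R * q n.+2 m.+2 + (n.+2 - m.+1)%:R / n.+2%:R * q n.+2 m.+1).
  have /eqP := q_rec (le_mn : 0 < m.+1 <= n.+1)%N.
  by rewrite -subr_eq -(phiS n) => /eqP <-; ring.
rewrite phi_q.
have -> : 'C(n.+2, m.+2)%:R = n.+2%:R * 'C(n.+1, m.+1)%:R / m.+2%:R :> R.
  by apply: (canRL (mulfK m2)); rewrite -!natrM [in RHS]mul_bin_diag mulnC.
have -> : 'C(n.+2, m.+1)%:R = n.+2%:R * 'C(n.+1, m.+1)%:R / (n.+2 - m.+1)%:R :> R.
  by apply: (canRL (mulfK nm)); rewrite -!natrM [in RHS](mul_bin_down n.+2) mulnC.
move: n.+2%:R m.+2%:R (n.+2 - m.+1)%:R 'C(n.+1, m.+1)%:R n2 m2 nm C1.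
by move=> x y z t x0 y0 z0 t0; field; rewrite x0 y0 z0 t0.
Qed.

(** * The last part, and the determination of the decrement matrix *)

Section LastPart.
Variable r : nat -> R.
Hypothesis r1 : r 1 = 1.
Hypothesis r_rec : forall n,
  r n.+2 = \sum_(m < n.+1) q n.+2 m.+1 * r (n.+1 - m)%N.

(** Convolve [psi] with the differences of 1 / [phi]: row 0 gives the constant -1, whose differences
    vanish. The term [m = 0] is then the wanted difference, and the others are those of [r_rec]. *)
Lemma last_part_bdiff n : r n.+1 = n.+1%:R * bdiff (fun i => (phi i)^-1) n 0.
Proof.
elim/ltn_ind: n => -[_|n IHn]; first by rewrite bdiff0 r1 phi0 invr1 mulr1.
have /= := bdiff_convolution (fun i => (phi i)^-1) psiD n.+1 0.
have -> : (fun i => psi i 0 * (phi i)^-1) = fun=> -1.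
  by apply/funext => i; rewrite /psi /= mulNr divff // gt_eqF // phi_gt0.
rewrite bdiff_cst big_ord_recl /= add0n bin0 mul1r.
rewrite {1}/psi eqxx mulNr => /eqP; rewrite addrC subr_eq0 => /eqP E.
have n2 : n.+2%:R != 0 :> R by rewrite pnatr_eq0.
apply: (mulfI (lt0r_neq0 (phi_gt0 n.+1))); rewrite mulrCA -E r_rec !mulr_sumr.
apply: eq_bigr => -[m /= ltmn] _; rewrite subSn -1?ltnS // IHn ?ltnS ?leq_subr //.
rewrite /psi /bump add1n subSS /=.
have C2 : 'C(n.+2, m.+1)%:R != 0 :> R by apply: bin_neq0; rewrite ltnS ltnW.
have -> : 'C(n.+1, m.+1)%:R = (n - m).+1%:R * 'C(n.+2, m.+1)%:R / n.+2%:R :> R.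
  apply: (canRL (mulfK n2)); rewrite -!natrM mulnC (mul_bin_down n.+2).
  by rewrite subSS subSn -1?ltnS.
move: n.+2%:R (n - m).+1%:R 'C(n.+2, m.+1)%:R n2 C2 => x y z x0 z0.
by field; rewrite x0 z0.
Qed.

Lemma decrement_alpha : (forall n, r n.+2 = q n.+2 1) ->
  exists2 al : R, 0 <= al <= 1 & forall n m, (0 < m <= n.+1)%N ->
    q n.+1 m = alpha_decrement al n.+1 m.
Proof.
move=> rq.
have qE n : q n.+2 1 / n.+2%:R = 1 - phi n / phi n.+1.
  rewrite -[phi n](phiS n) mulrAC divff ?lt0r_neq0 ?phi_gt0 // mul1r.
  by rewrite opprB addrC subrK.
(* The increments [phi n.+1 - phi n = psi n.+1 1] decrease in [n], so a zero first increment,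
   together with monotonicity of [phi], makes all of them zero. *)
have phi_cst : phi 1 = 1 -> forall n, phi n = 1.
  move=> phi1.
  have psi_le n : psi n.+1 1 <= psi n 1.
    rewrite (@psiD n) // lerDl /psi /=.
    by rewrite divr_ge0 ?ler0n // mulr_ge0 // ltW ?phi_gt0.
  have psi_le0 n : psi n.+1 1 <= 0.
    elim: n => [|n]; last by apply: le_trans.
    have := @psiD 0 0 isT; rewrite /psi /= phi0 phi1; lra.
  elim=> [|n IHn]; first exact: phi0.
  apply/le_anti/andP; split; last by rewrite -phi0 phi_le.
  by have := @psiD n 0 isT; have := psi_le0 n; rewrite {2 3}/psi /= IHn; lra.
have phiE : forall n, (phi n)^-1 = alpha_inv_phi (phi 1 - 1) n.
  apply: (phi_unique phi0 phi_le phi_cst) => n.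
  by rewrite -qE -rq last_part_bdiff mulrC mulKf ?pnatr_eq0.
move: phiE; set al := phi 1 - 1 => phiE.
have al_ge0 : 0 <= al by rewrite subr_ge0 -[leLHS]phi0 phi_le.
(* [phi 1] is 2 / (2 - [q 2 1]), at most 2. *)
have al_le1 : al <= 1.
  rewrite /al lerBlDr /phi big_ord1 /= ler_pdivrMr ?decrement_factor_gt0 //.
  by have := q_le1 1 1; lra.
exists al; first by rewrite al_ge0 al_le1.
have fact_neq0 n : n`!%:R != 0 :> R by rewrite pnatr_eq0 -lt0n fact_gt0.
have ris_neq0 n : rising (al + 1) n != 0.
  by rewrite gt_eqF // rising_gt0 // ltr_wpDl.
have {}phiE n : phi n = rising (al + 1) n / n`!%:R.
  by rewrite -[LHS]invrK phiE /alpha_inv_phi invf_div.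
(* Increments of [phi] give column 1 of [psi]; [psiD] then yields each column from the preceding
   one. *)
have psiE m n : (m <= n)%N ->
    psi n m.+1 = rising (1 - al) m * rising al (n - m) / n`!%:R.
  elim: m n => [|m IHm] [|n] // le_mn.
  - by rewrite /psi /= phi0 q11 !rising0 bin1 !mul1r.
  - have := @psiD n 0 isT; rewrite {1 2}/psi /= => E.
    have -> : psi n.+1 1 = phi n.+1 - phi n by rewrite E; ring.
    rewrite !phiE rising0 risingS risingSl factS natrM -natr1.
    have := fact_neq0 n; have : n%:R + 1 != 0 :> R by rewrite natr1 pnatr_eq0.
    by move=> h1 h2; field; rewrite h1 h2.
  - have := @psiD n m.+1 le_mn => /eqP; rewrite addrC -subr_eq => /eqP <-.
    rewrite !IHm //; last exact: ltnW.
    rewrite subSn // !risingS factS natrM subSS natrB // -natr1.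
    have := fact_neq0 n; have : n%:R + 1 != 0 :> R by rewrite natr1 pnatr_eq0.
    by move=> h1 h2; field; rewrite h1 h2.
move=> n [|m] // /andP[_ le_mn].
rewrite /alpha_decrement /= subSS.
have := psiE m n le_mn; rewrite /psi /= phiE.
have C1 := bin_neq0 le_mn; have := fact_neq0 n; have := ris_neq0 n.
move: 'C(n.+1, m.+1)%:R C1 (rising (al + 1) n) n`!%:R => z z0 x y x0 y0 E.
transitivity (z * y / x * (x / y * q n.+1 m.+1 / z)).
  by field; rewrite x0 y0 z0.
by rewrite E; field; rewrite x0 y0.
Qed.

End LastPart.
End DecrementMatrix.

(** * Compositions and their laws *)

Section Compositions.

Fixpoint bounded_seqs (b k : nat) : seq (seq nat) :=
  if k is k'.+1 then
    [::] :: [seq m :: l | m <- iota 0 b.+1, l <- bounded_seqs b k']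
  else [:: [::]].

(** A duplicate-free list of all values of [C n], over which probabilities become finite sums.
    Positive parts summing to [n] are at most [n] in number and in size, so the bounds lose
    nothing. *)
Definition compositions n : seq (seq nat) :=
  undup [seq l <- bounded_seqs n n | is_composition n l].

Lemma mem_bounded_seqs b k l :
  (size l <= k)%N -> all (geq b) l -> l \in bounded_seqs b k.
Proof.
elim: k l => [|k IHk] [|m l] // lk /andP[mb lb].
have -> : bounded_seqs b k.+1 =
    [::] :: [seq m :: l | m <- iota 0 b.+1, l <- bounded_seqs b k] by [].
rewrite inE; apply/orP; right; apply/allpairsPdep; exists m, l.
by split; [rewrite mem_iota | exact: IHk |].
Qed.

Lemma mem_compositions n l : (l \in compositions n) = is_composition n l.
Proof.
rewrite mem_undup mem_filter; case: (boolP (is_composition n l)) => //= cl.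
apply: mem_bounded_seqs; case/andP: cl => l1 /eqP <-.
  by elim: l l1 => //= m l IHl /andP[m1 /IHl]; rewrite -add1n => /(leq_add m1).
elim: l {l1} => //= m l IHl; rewrite leq_addr /=.
by apply: sub_all IHl => k /leq_trans; apply; exact: leq_addl.
Qed.

Lemma compositions_uniq n : uniq (compositions n).
Proof. exact: undup_uniq. Qed.

Lemma filter_parts l : all (leq 1) l -> [seq m <- l | m != 0%N] = l.
Proof. by move=> l1; apply/all_filterP; apply: sub_all l1 => m; rewrite lt0n. Qed.

Lemma composition_single n l :
  (0 < n)%N -> is_composition n l -> first_part l = n -> l = [:: n].
Proof.
case: l => [|a [|b t]] /=; first by move=> + _ n0; rewrite -n0.
  by rewrite /first_part /= => _ _ ->.
move=> _ /andP[/= /and3P[_ b1 _] /eqP <-] /eqP.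
rewrite /first_part /= -[X in X == _]addn0 eqn_add2l eq_sym addn_eq0.
by rewrite -leqn0 leqNgt b1.
Qed.

Lemma discard0 a t : all (leq 1) t ->
  discard (a :: t) 0 = if a.-1 == 0%N then t else a.-1 :: t.
Proof. by move=> t1; rewrite /discard /= filter_parts //; case: eqP. Qed.

Lemma discardS a t i : (0 < a)%N -> discard (a :: t) i.+1 = a :: discard t i.
Proof. by rewrite /discard /= lt0n => ->. Qed.

Lemma discard_composition n l i : is_composition n.+1 l -> (i < size l)%N ->
  is_composition n (discard l i).
Proof.
elim: l n i => // a t IHt n [|i] /andP[/= /andP[a1 t1] /eqP sum_l] ilt.
  rewrite discard0 // /is_composition; case: a a1 sum_l => // a _ [] <-.
  case: eqP => [/= ->|/=]; rewrite t1 ?eqxx //= => /eqP.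
  by rewrite -lt0n => ->.
have t_gt0 : (0 < sumn t)%N.
  by case: t t1 ilt {IHt sum_l} => //= b t /andP[b1 _] _; rewrite addn_gt0 b1.
have := IHt (sumn t).-1 i; rewrite prednK // /is_composition t1 eqxx => /(_ isT ilt).
case/andP=> d1 /eqP sum_d; rewrite discardS //= a1 d1 sum_d /=.
by rewrite -eqSS -sum_l -addnS prednK.
Qed.

Lemma sum_nth (l : seq nat) : (\sum_(i < size l) nth 0 l i = sumn l)%N.
Proof. by elim: l => [|a l IHl]; rewrite ?big_ord0 // big_ord_recl IHl. Qed.

(** The new first part is [m] in three ways: a first part [m.+1] loses a ball, a first part [m]
    keeps all of its balls, or a singleton first box disappears before a part [m]. *)
Lemma discard_first_part (R : realType) n m l :
  is_composition n.+2 l -> (0 < m)%N ->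
  \sum_(i < size l | first_part (discard l i) == m) (nth 0%N l i)%:R / (sumn l)%:R
  = m.+1%:R / n.+2%:R * (first_part l == m.+1)%:R
    + (n.+2 - m)%:R / n.+2%:R * (first_part l == m)%:R
    + ((first_part l == 1%N) && (first_part (behead l) == m))%:R / n.+2%:R :> R.
Proof.
case: l => // a t /andP[/= /andP[a1 t1] /eqP sum_l] m_gt0.
rewrite sum_l -mulr_suml big_mkcond big_ord_recl /= discard0 //.
under eq_bigr do rewrite discardS //=.
rewrite -!mulrA ![n.+2%:R^-1 * _]mulrC !mulrA -!mulrDl; congr (_ / _).
have -> : \sum_(i < size t) (if a == m then (nth 0%N t i)%:R else 0) =
          (n.+2 - m)%:R * (a == m)%:R :> R.
  case: eqP => [<-|_]; last by rewrite big1 ?mulr0.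
  by rewrite -natr_sum sum_nth -sum_l addKn mulr1.
rewrite [RHS]addrAC; congr (_ + _).
case: a a1 {sum_l} => // -[|a] _ /=.
  (* A singleton first box counts only in the third term, since [0 < m] excludes [m.+1 = 1]. *)
  by rewrite eqSS (ltn_eqF m_gt0) mulr0 add0r; case: eqP.
by rewrite eqSS addr0; case: eqP => [<-|]; rewrite ?mulr1 ?mulr0.
Qed.

Lemma last_part_rev l : last_part (rev l) = first_part l.
Proof. by case: l => // a l; rewrite /last_part rev_cons last_rcons. Qed.

End Compositions.

(** * Probabilities as finite sums *)

Section Events.
Context {d : measure_display} {T : measurableType d} {R : realType}.
Variable P : probability T R.

Lemma Pr_ge0 A : 0 <= Pr P A.
Proof. exact: fine_ge0. Qed.

Lemma Pr_le A B : measurable A -> measurable B -> A `<=` B -> Pr P A <= Pr P B.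
Proof.
move=> mA mB AB; apply: fine_le; rewrite ?fin_num_measure //.
by apply: le_measure; rewrite ?inE.
Qed.

Lemma Pr_le1 A : measurable A -> Pr P A <= 1.
Proof.
move=> mA; apply: le_trans (Pr_le mA measurableT (@subsetT _ _)) _.
by rewrite /Pr probability_setT.
Qed.

Lemma Pr_sub0 A B : measurable A -> measurable B -> A `<=` B -> Pr P B = 0 ->
  Pr P A = 0.
Proof. by move=> mA mB AB B0; apply/le_anti; rewrite Pr_ge0 -[leRHS]B0 Pr_le. Qed.

Lemma Pr_setT A : (forall w, A w) -> Pr P A = 1.
Proof.
move=> AT; have -> : A = setT by apply/seteqP; split.
by rewrite /Pr probability_setT.
Qed.

Lemma Pr_partition (S : eqType) (X : T -> S) (L : seq S) (D : set T) :
  measurable D -> (forall s, measurable [set w | X w = s]) -> uniq L ->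
  (forall w, D w -> X w \in L) ->
  Pr P D = \sum_(s <- L) Pr P (D `&` [set w | X w = s]).
Proof.
move=> + mX; elim: L D => [|s L IHL] D mD /= => [_ D0|/andP[sL uL] DL].
  rewrite big_nil; have -> : D = set0 by apply/seteqP; split=> // w /D0.
  by rewrite /Pr measure0.
have mDs := measurableD mD (mX s).
rewrite big_cons /Pr (measureDI P mD (mX s)) fineD ?fin_num_measure //; last first.
  exact: measurableI.
rewrite addrC -/(Pr P _) -/(Pr P _); congr (_ + _).
rewrite (IHL _ mDs uL) => [|w [/DL + /eqP Xs]]; last first.
  by rewrite inE (negPf Xs).
apply: eq_big_seq => s' s'L; congr (Pr P _); apply/seteqP; split=> w /=.
  by case=> -[].
move=> [Dw Xw]; split=> //; split=> // Xs.
by rewrite -Xs Xw s'L in sL.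
Qed.

End Events.

Section CompositionStructure.
Context {d : measure_display} {T : measurableType d} {R : realType}.
Variables (P : probability T R) (C : nat -> T -> seq nat).
Hypothesis hC : random_compositions C.

Lemma compositionP n w : (0 < n)%N -> is_composition n (C n w).
Proof. by move=> /hC[]. Qed.

Lemma measurable_composition n (A : set (seq nat)) : (0 < n)%N ->
  measurable [set w | A (C n w)].
Proof.
move=> n_gt0.
have -> : [set w | A (C n w)] =
    \big[setU/set0]_(l <- compositions n | `[< A l >]) [set w | C n w = l].
  rewrite -bigcup_seq_cond; apply/seteqP; split=> [w Aw|w [l /= /andP[_ /asboolP Al] ->]] //.
  exists (C n w) => //=; rewrite mem_compositions compositionP //.
  exact/asboolP.
by apply: bigsetU_measurable => l _; have [_] := hC n_gt0.
Qed.

Lemma Pr_compositions n (A : pred (seq nat)) : (0 < n)%N ->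
  Pr P [set w | A (C n w)] =
  \sum_(l <- compositions n) (A l)%:R * Pr P [set w | C n w = l].
Proof.
move=> n_gt0; rewrite (@Pr_partition _ _ _ _ _ (C n) (compositions n)).
- apply: eq_bigr => l _; case: (boolP (A l)) => Al; rewrite ?(mul1r, mul0r).
    congr (Pr P _); apply/seteqP; split=> w /= => [[]//|Cl].
    by rewrite Cl.
  have -> : [set w | A (C n w)] `&` [set w | C n w = l] = set0.
    by apply/seteqP; split=> // w /= [+ Cl]; rewrite Cl (negPf Al).
  by rewrite /Pr measure0.
- exact: (@measurable_composition n [set l | A l]).
- by move=> l; have [_] := hC n_gt0.
- exact: compositions_uniq.
- by move=> w _; rewrite mem_compositions compositionP.
Qed.

End CompositionStructure.

(** * Recursions for the first and last parts *)

Section RegenerativeStructure.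
Context {d : measure_display} {T : measurableType d} {R : realType}.
Variables (P : probability T R) (C : nat -> T -> seq nat).
Hypothesis hC : composition_structure P C.
Hypothesis hreg : regenerative P C.

Let hC0 : random_compositions C. Proof. by case: hC. Qed.

Let mE n (A : set (seq nat)) : measurable [set w | A (C n.+1 w)].
Proof. exact: (measurable_composition hC0). Qed.

Definition decrement n m : R := Pr P [set w | first_part (C n w) = m].

Lemma decrement_compositions n m : decrement n.+1 m =
  \sum_(l <- compositions n.+1) (first_part l == m)%:R * Pr P [set w | C n.+1 w = l].
Proof.
rewrite -(@Pr_compositions _ _ _ P C hC0 _ (fun l => first_part l == m)) //.
by congr (Pr P _); apply/seteqP; split=> w /eqP.
Qed.

(** Regeneration in product form, free of conditioning: when the first part is almost surely not
    [m], both sides are 0. *)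
Lemma Pr_first_part n m (A : set (seq nat)) : (0 < m < n)%N ->
  Pr P [set w | first_part (C n w) = m /\ A (behead (C n w))] =
  decrement n m * Pr P [set w | A (C (n - m)%N w)].
Proof.
case: n => [|n]; first by rewrite ltn0 andbF.
move=> mn; have mF := mE n [set l | first_part l = m].
have mFA := mE n [set l | first_part l = m /\ A (behead l)].
have [F0|F_neq0] := eqVneq (decrement n.+1 m) 0.
  by rewrite F0 mul0r; apply: (Pr_sub0 mFA mF) => // w [].
rewrite -(hreg mn) ?lt0r ?F_neq0 ?Pr_ge0 // /cPr mulrC divfK //.
by congr (Pr P _); apply/seteqP; split=> w [].
Qed.

Lemma Pr_next_composition n l' : Pr P [set w | C n.+1 w = l'] =
  \sum_(l <- compositions n.+2) Pr P [set w | C n.+2 w = l] * discard_prob R l l'.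
Proof.
rewrite (@Pr_partition _ _ _ _ _ (C n.+2) (compositions n.+2)).
- apply: eq_bigr => l _.
  have mF := mE n.+1 [set l].
  have mFA := measurableI _ _ (mE n [set l']) mF.
  have [F0|F_neq0] := eqVneq (Pr P [set w | C n.+2 w = l]) 0.
    by rewrite F0 mul0r; apply: (Pr_sub0 mFA mF) => // w [].
  have [_ _ hS] := hC; rewrite -(hS n.+1) ?lt0r ?F_neq0 ?Pr_ge0 //.
  by rewrite /cPr mulrC divfK.
- exact: (mE n [set l']).
- by move=> l; exact: (mE n.+1 [set l]).
- exact: compositions_uniq.
- by move=> w _; rewrite mem_compositions compositionP.
Qed.

(** Averages the three cases of [discard_first_part] over [C n.+2]. By regeneration, the product is
    the probability that the first two parts are 1 and [m]. *)
Lemma decrement_rec n m : (0 < m <= n.+1)%N ->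
  decrement n.+1 m = (m.+1)%:R / n.+2%:R * decrement n.+2 m.+1
    + (n.+2 - m)%:R / n.+2%:R * decrement n.+2 m
    + decrement n.+2 1 * decrement n.+1 m / n.+2%:R.
Proof.
case/andP=> m_gt0 le_mn.
have -> : decrement n.+2 1 * decrement n.+1 m =
    \sum_(l <- compositions n.+2)
       ((first_part l == 1%N) && (first_part (behead l) == m))%:R
         * Pr P [set w | C n.+2 w = l].
  rewrite -(@Pr_compositions _ _ _ P C hC0 _
    (fun l => (first_part l == 1%N) && (first_part (behead l) == m))) //.
  have := @Pr_first_part n.+2 1 [set l | first_part l = m] isT.
  rewrite subn1 => <-; congr (Pr P _); apply/seteqP; split=> w /=.
    by case=> -> ->; rewrite !eqxx.
  by case/andP=> /eqP -> /eqP ->.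
rewrite !decrement_compositions !mulr_sumr mulr_suml -!big_split /=.
under eq_bigr do rewrite Pr_next_composition mulr_sumr.
rewrite exchange_big /=; apply: eq_big_seq => l; rewrite mem_compositions => cl.
under eq_bigr do rewrite mulrCA.
rewrite -mulr_sumr mulrC [RHS](_ : _ =
  (m.+1%:R / n.+2%:R * (first_part l == m.+1)%:R
    + (n.+2 - m)%:R / n.+2%:R * (first_part l == m)%:R
    + ((first_part l == 1%N) && (first_part (behead l) == m))%:R / n.+2%:R)
  * Pr P [set w | C n.+2 w = l]); last by ring.
rewrite -discard_first_part //; congr (_ * _).
under eq_bigr do rewrite /discard_prob mulr_sumr big_mkcond.
rewrite exchange_big /= [RHS]big_mkcond; apply: eq_bigr => i _.
have di : discard l i \in compositions n.+1.
  by rewrite mem_compositions discard_composition.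
(* Once the box [i] is chosen, the resulting composition is determined, so the sum over [l'] has one
   term. *)
rewrite (bigD1_seq (discard l i)) ?compositions_uniq //= eqxx big1 ?addr0.
  by case: eqP; rewrite (mul1r, mul0r).
by move=> l' /negPf; rewrite eq_sym => ->.
Qed.

Definition last_one n : R := Pr P [set w | last_part (C n w) = 1%N].

Lemma composition_one w : C 1 w = [:: 1%N].
Proof.
have /andP[] := compositionP hC0 w (isT : 0 < 1)%N.
case: (C 1 w) => [|a [|b l]] //= /andP[a1]; first by rewrite addn0 => _ /eqP->.
case: a b a1 => [|a] [|b] // _ _.
by rewrite !addSn eqSS addnS.
Qed.

(** Split on the first part: unless it is everything, the last part is that of the remainder, to
    which regeneration applies. The one-part composition contributes 0, as its part [n.+2] is not
    1. *)
Lemma last_one_rec n :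
  last_one n.+2 = \sum_(m < n.+1) decrement n.+2 m.+1 * last_one (n.+1 - m)%N.
Proof.
have mL := mE n.+1 [set l | last_part l = 1%N].
have mF m := mE n.+1 [set l | first_part l = m].
rewrite {1}/last_one (@Pr_partition _ _ _ _ _ (first_part \o C n.+2) (iota 1 n.+2)) //.
- have -> : iota 1 n.+2 = map succn (index_iota 0 n.+2).
    by rewrite /index_iota (iotaDl 1 0).
  rewrite big_map big_mkord big_ord_recr /= [X in _ + X](_ : _ = 0).
    rewrite addr0; apply: eq_bigr => -[m mn] _ /=.
    have := @Pr_first_part n.+2 m.+1 [set l | last_part l = 1%N] mn.
    rewrite subSS => <-; congr (Pr P _); apply/seteqP; split=> w /=.
      move=> [lw fw]; split=> //.
      move: (compositionP hC0 w (isT : 0 < n.+2)%N) lw fw.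
      case: (C n.+2 w) => [|a [|b l]] //= /andP[_] /=.
      rewrite addn0 => /eqP -> _ [E]; move: mn; rewrite -E.
      by rewrite ltnn.
    move=> [fw lw]; split=> //; move: lw.
    by rewrite /last_part; case: (C n.+2 w) => [|a [|b l]].
  rewrite [X in Pr P X](_ : _ = set0); first by rewrite /Pr measure0.
  apply/seteqP; split=> // w /= [lw fw].
  move: lw; have := compositionP hC0 w (isT : 0 < n.+2)%N.
  by move=> /composition_single ->.
- exact: iota_uniq.
- move=> w _; rewrite mem_iota /=; move: (compositionP hC0 w (isT : 0 < n.+2)%N).
  by case: (C n.+2 w) => // a l /andP[/= /andP[-> _] /eqP <-]; rewrite ltnS leq_addr.
Qed.

(** Peeling off first parts, regeneration and [alpha_cpf_cons] give the same recursion on both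
    sides. *)
Lemma cpf_alpha (al : R) : 0 <= al ->
  (forall n m, (0 < m <= n)%N -> decrement n m = alpha_decrement al n m) ->
  forall l, l != [::] -> all (leq 1) l -> cpf P C l = alpha_cpf al l.
Proof.
move=> al_ge0 dE; elim=> // a l IHl _ /= /andP[a1 l1].
have [->|l_neq0] := eqVneq l [::].
  rewrite alpha_cpf1 // -dE ?a1 ?leqnn // /cpf /decrement /= addn0.
  congr (Pr P _); apply/seteqP; split=> w /= [E]; first by rewrite E.
  exact: composition_single a1 (compositionP hC0 w a1) E.
have s_gt0 : (0 < sumn l)%N.
  by case: (l) l_neq0 l1 => //= b t _ /andP[b1 _]; rewrite addn_gt0 b1.
rewrite alpha_cpf_cons // -IHl // -dE ?a1 ?leq_addr //.
have -> : cpf P C l = Pr P [set w | [set l] (C (a + sumn l - a)%N w)] by rewrite addKn.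
rewrite -Pr_first_part; last by rewrite a1 -[X in (X < _)%N]addn0 ltn_add2l.
rewrite /cpf /=; congr (Pr P _); apply/seteqP; split=> w /= => [->//|[]].
have : (0 < a + sumn l)%N by rewrite addn_gt0 a1.
move=> /(compositionP hC0 w); case: (C _ w) => [|b t] /= _; last first.
  by rewrite /first_part /= => -> ->.
by move=> a0; move: a1; rewrite -a0.
Qed.

(** [rev] permutes the compositions of a given integer, and symmetry equates the probabilities of
    [l] and [rev l]. *)
Lemma reversible_of_symmetric : symmetric_structure P C -> reversible P C.
Proof.
move=> sym [|n] // _ A.
have E B : Pr P (C n.+1 @^-1` B) =
    \sum_(l <- compositions n.+1) (`[< B l >])%:R * cpf P C l.
  rewrite (_ : _ @^-1` _ = [set w | `[< B (C n.+1 w) >]]); last first.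
    by apply/seteqP; split=> w /asboolP.
  rewrite (Pr_compositions P hC0 (fun l => `[< B l >])) //.
  apply: eq_big_seq => l; rewrite mem_compositions => /andP[_ /eqP sl].
  by rewrite /cpf sl.
have rev_comp l : is_composition n.+1 (rev l) = is_composition n.+1 l.
  by rewrite /is_composition all_rev sumn_rev.
rewrite E (_ : _ @^-1` A = C n.+1 @^-1` (rev @^-1` A)) // E.
have /(perm_big _) -> : perm_eq (compositions n.+1) (map rev (compositions n.+1)).
  apply: uniq_perm; rewrite ?compositions_uniq //.
    by rewrite map_inj_uniq ?compositions_uniq //; exact: inv_inj revK.
  move=> l; rewrite -[in RHS](revK l) mem_map; last exact: inv_inj revK.
  by rewrite !mem_compositions rev_comp.
rewrite big_map; apply: eq_big_seq => l; rewrite mem_compositions => cl.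
rewrite /preimage /= revK; congr (_ * _); apply: sym.
- by rewrite -size_eq0 size_rev size_eq0; case: (l) cl.
- by rewrite all_rev; case/andP: cl.
- by rewrite perm_rev.
Qed.

End RegenerativeStructure.

(** * Closing the cycle of implications *)

Theorem theorem10p1 (d : measure_display) (T : measurableType d)
    (R : realType) (P : probability T R)
    (C : nat -> T -> seq nat) (Rt : T -> set R)
    (hC : composition_structure P C)
    (hreg : regenerative P C)
    (hRt : random_closed_set Rt)
    (hder : derived_by_uniform_sampling P C Rt) :
  [<-> (* (i) *)
       forall n : nat, (0 < n)%N ->
         Pr P [set w | first_part (C n w) = 1%N] =
         Pr P [set w | last_part (C n w) = 1%N];
       (* (ii) *)
       forall n : nat, (0 < n)%N ->
         eq_law P (fun w => first_part (C n w)) (fun w => last_part (C n w));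
       (* (iii) *)
       reversible P C;
       (* (iv) *)
       symmetric_structure P C;
       (* (v) *)
       exists alpha : R, 0 <= alpha <= 1 /\
         forall l : seq nat, l != [::] -> all (leq 1%N) l ->
           cpf P C l = alpha_cpf alpha l].
Proof.
have hC0 : random_compositions C by case: hC.
have i_v : (forall n : nat, (0 < n)%N ->
         Pr P [set w | first_part (C n w) = 1%N] =
         Pr P [set w | last_part (C n w) = 1%N]) ->
    exists al : R, 0 <= al <= 1 /\
         forall l : seq nat, l != [::] -> all (leq 1%N) l ->
           cpf P C l = alpha_cpf al l.
  move=> FL.
  have [al al01 dE] : exists2 al : R, 0 <= al <= 1 & forall n m,
      (0 < m <= n.+1)%N -> decrement P C n.+1 m = alpha_decrement al n.+1 m.
    apply: (@decrement_alpha _ (decrement P C) _ _ _ _ (last_one P C)).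
    - by move=> n m; exact: Pr_ge0.
    - move=> n m; apply: Pr_le1.
      exact: (measurable_composition hC0 [set l | first_part l = m]).
    - by apply: Pr_setT => w; rewrite /= (composition_one hC).
    - exact: (decrement_rec hC hreg).
    - by apply: Pr_setT => w; rewrite /= (composition_one hC).
    - exact: (last_one_rec hC hreg).
    - by move=> n; rewrite /last_one -FL.
  exists al; split=> //; apply: (cpf_alpha hC hreg) => //; first by case/andP: al01.
  by case=> [|n] m; [case: m|exact: dE].
have ii_i : (forall n : nat, (0 < n)%N ->
         eq_law P (fun w => first_part (C n w)) (fun w => last_part (C n w))) ->
    forall n : nat, (0 < n)%N ->
         Pr P [set w | first_part (C n w) = 1%N] =
         Pr P [set w | last_part (C n w) = 1%N].
  by move=> FL n n_gt0; exact: (FL n n_gt0 [set 1%N]).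
have iii_ii : reversible P C -> forall n : nat, (0 < n)%N ->
         eq_law P (fun w => first_part (C n w)) (fun w => last_part (C n w)).
  move=> rv n n_gt0 A; rewrite -[RHS](rv n n_gt0 [set l | A (last_part l)]).
  congr (Pr P _); apply/seteqP; rewrite /preimage /=.
  by split=> w /=; rewrite last_part_rev.
have iv_iii := reversible_of_symmetric hC.
have v_iv : (exists al : R, 0 <= al <= 1 /\
         forall l : seq nat, l != [::] -> all (leq 1%N) l ->
           cpf P C l = alpha_cpf al l) -> symmetric_structure P C.
  move=> [al [_ cE]] l l' l0 l1 ll'.
  rewrite !cE //; first exact: alpha_cpf_perm.
    by rewrite -size_eq0 -(perm_size ll') size_eq0.
  by rewrite -(perm_all _ ll').
(* The implications run (i), (v), (iv), (iii), (ii), (i), against the listed order, so each goal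
   takes four of them. *)
tfae=> [/i_v/v_iv/iv_iii/iii_ii|/ii_i/i_v/v_iv/iv_iii|/iii_ii/ii_i/i_v/v_iv
  |/iv_iii/iii_ii/ii_i/i_v|/v_iv/iv_iii/iii_ii/ii_i] //.
Qed.
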